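(* Let $n,m,p\ge 1$, let $\mathcal{U},\mathcal{W}\subset\mathbb{Z}$ be nonempty finite sets, and let $B\in\mathbb{Z}^{n\times m}$, $D\in\mathbb{Z}^{n\times p}$. Consider the system $x(t+1)=x(t)+Bu(t)-Dw(t)$, $t\in\mathbb{Z}_+$, with state $x(t)\in\mathbb{R}^n$, control input $u(t)\in\mathcal{U}^m$ and disturbance input $w(t)\in\mathcal{W}^p$. The following two statements are equivalent: (a) There exists a hyperbox $X=[0,x_1^+]\times\cdots\times[0,x_n^+]$ that is robustly control invariant. (b) $\mathcal{U}_z\neq\emptyset$ for all $z\in\mathbb{B}^n$.
   Context: $\mathbb{Z}_+$ denotes the non-negative integers, $[x]_i$ the $i$-th component of a vector $x$, and $\mathbb{B}^n=\{0,1\}^n$. For $i\in\{1,\dots,n\}$ define $\mathcal{U}_+^i=\{u\in\mathcal{U}^m : [Bu-Dw]_i\ge 0\ \forall w\in\mathcal{W}^p\}$ and $\mathcal{U}_-^i=\{u\in\mathcal{U}^m : [Bu-Dw]_i\le 0\ \forall w\in\mathcal{W}^p\}$. The signature of $x\in\mathbb{R}_+^n$ (non-negative entries) is the $n$-tuple $(s_1,\dots,s_n)$ with $s_i=+$ if $[x]_i=0$ and $s_i=-$ if $[x]_i>0$. For $x$ with signature $(s_1,\dots,s_n)$, $\mathcal{U}_x=\mathcal{U}_{s_1}^1\cap\cdots\cap\mathcal{U}_{s_n}^n$. A hyperbox is a set $X=[0,x_1^+]\times\cdots\times[0,x_n^+]\subset\mathbb{R}^n$ with real numbers $x_i^+\ge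 0$. It is robustly control invariant if there exists a control law $\varphi:X\to\mathcal{U}^m$ such that for every $x\in X$ and every $w\in\mathcal{W}^p$, $x+B\varphi(x)-Dw\in X$. *)

(* Defs.v *)
From HB Require Import structures.
From mathcomp Require Import all_boot all_order all_algebra.
From mathcomp Require Import boolp classical_sets functions cardinality reals.

Set Implicit Arguments.
Unset Strict Implicit.
Unset Printing Implicit Defensive.

Import Order.TTheory GRing.Theory Num.Theory.

Local Open Scope classical_set_scope.
Local Open Scope ring_scope.

(* The Cartesian power S^k, as column vectors with all entries in S. *)
Definition vec_pow (S : set int) (k : nat) : set 'cV[int]_k :=
  [set v | forall i, S (v i 0)].

Definition next_state (R : realType) (n m p : nat)
    (B : 'M[int]_(n, m)) (D : 'M[int]_(n, p))
    (x : 'cV[R]_n) (u : 'cV[int]_m) (w : 'cV[int]_p) : 'cV[R]_n :=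
  x + map_mx intr (B *m u) - map_mx intr (D *m w).

Inductive sign := Plus | Minus.

Definition U_plus (U W : set int) (n m p : nat)
    (B : 'M[int]_(n, m)) (D : 'M[int]_(n, p)) (i : 'I_n) : set 'cV[int]_m :=
  [set u | vec_pow U u /\
           forall w, vec_pow W w -> 0 <= (B *m u - D *m w) i 0].

Definition U_minus (U W : set int) (n m p : nat)
    (B : 'M[int]_(n, m)) (D : 'M[int]_(n, p)) (i : 'I_n) : set 'cV[int]_m :=
  [set u | vec_pow U u /\
           forall w, vec_pow W w -> (B *m u - D *m w) i 0 <= 0].

Definition U_sign (U W : set int) (n m p : nat)
    (B : 'M[int]_(n, m)) (D : 'M[int]_(n, p)) (s : sign) (i : 'I_n) :
    set 'cV[int]_m :=
  match s with
  | Plus => U_plus U W B D i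
  | Minus => U_minus U W B D i
  end.

(* Only meaningful for x with non-negative entries, where the Plus case is
   exactly x i 0 = 0. *)
Definition signature (R : realType) (n : nat) (x : 'cV[R]_n) (i : 'I_n) : sign :=
  if 0 < x i 0 then Minus else Plus.

(* For n = 0 the empty intersection would be the full type rather than U^m;
   the set is only used with n >= 1. *)
Definition U_at (R : realType) (U W : set int) (n m p : nat)
    (B : 'M[int]_(n, m)) (D : 'M[int]_(n, p)) (x : 'cV[R]_n) :
    set 'cV[int]_m :=
  \bigcap_(i in [set: 'I_n]) U_sign U W B D (signature x i) i.

(* {0,1}^n, seen inside R^n. *)
Definition binary_vec (R : realType) (n : nat) : set 'cV[R]_n :=
  [set z | forall i, z i 0 = 0 \/ z i 0 = 1].

Definition is_hyperbox (R : realType) (n : nat) (X : set 'cV[R]_n) : Prop :=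
  exists xplus : 'cV[R]_n,
    (forall i, 0 <= xplus i 0) /\
    X = [set x | forall i, 0 <= x i 0 <= xplus i 0].

(* The control law X -> U^m is encoded as a total function mapping X into U^m;
   its values outside X are irrelevant. *)
Definition robustly_control_invariant (R : realType) (U W : set int)
    (n m p : nat) (B : 'M[int]_(n, m)) (D : 'M[int]_(n, p))
    (X : set 'cV[R]_n) : Prop :=
  exists phi : 'cV[R]_n -> 'cV[int]_m,
    set_fun X (vec_pow U (k := m)) phi /\
    forall x w, X x -> vec_pow W w -> X (next_state B D x (phi x) w).

(* Main.v *)
Require Import Defs.
From mathcomp Require Import all_boot all_order all_algebra.
From mathcomp Require Import boolp classical_sets functions cardinality reals.
From mathcomp Require Import lra.

(** Both directions rest on the fact that, in coordinate [i], the state moves by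
the integer [(B *m u - D *m w) i 0], and that [U_at] at a binary vector [z]
collects the controls that never decrease the coordinates with [z i 0 = 0] and
never increase those with [z i 0 = 1].

If a hyperbox is invariant, look at its vertex whose [i]-th coordinate is [0] or
the upper end [xplus i 0] according to [z i 0]. From there staying in the box
forbids any decrease at a lower end and any increase at an upper end, so the
control used at that vertex lies in [U_at] at [z]. A degenerate side, of length
zero, causes no trouble: it forbids any movement at all.

Conversely, finiteness of [U] and [W] bounds the movement of coordinate [i] by a
constant [b i] ([increment_bounded]). The box with sides [2 * b i] is invariant
when the law rounds each state to a binary vector, according to whether the
state lies in the upper or the lower half of each side, and plays a control
admissible for that vector: in the lower half the coordinate rises by at most
[b i], in the upper half it falls by at most [b i], so it cannot leave
its side ([next_state_coord_in_side]). The law cannot be read off from the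
signature of the state itself, since a small positive coordinate would then be
allowed to fall below [0]. *)

Set Implicit Arguments.
Unset Strict Implicit.

Import Order.TTheory GRing.Theory Num.Theory.
Local Open Scope classical_set_scope.
Local Open Scope ring_scope.

Lemma finite_int_set_bounded (S : set int) : finite_set S ->
  exists c : int, 0 <= c /\ forall a, S a -> `|a| <= c.
Proof.
move=> /finite_seqP [s ->]; exists (\sum_(a <- s) `|a|); split.
  exact: sumr_ge0.
move=> a /= a_in_s; rewrite (big_rem a) //= lerDl.
exact: sumr_ge0.
Qed.

Lemma mulmx_coord_bounded (S : set int) (n k : nat) (A : 'M[int]_(n, k)) :
  finite_set S ->
  exists b : 'I_n -> int, (forall i, 0 <= b i) /\
    forall v, vec_pow S v -> forall i, `|(A *m v) i 0| <= b i.
Proof.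
move=> /finite_int_set_bounded [c [c_ge0 le_c]].
exists (fun i => \sum_j `|A i j| * c); split=> [i|v Sv i].
  by apply: sumr_ge0 => j _; rewrite mulr_ge0.
rewrite mxE; apply: (le_trans (ler_norm_sum _ _ _)); apply: ler_sum => j _.
by rewrite normrM ler_wpM2l // le_c //; apply: Sv.
Qed.

Lemma increment_bounded (U W : set int) (n m p : nat)
    (B : 'M[int]_(n, m)) (D : 'M[int]_(n, p)) :
  finite_set U -> finite_set W ->
  exists b : 'I_n -> int, (forall i, 0 <= b i) /\
    forall u w, vec_pow U u -> vec_pow W w ->
      forall i, `|(B *m u - D *m w) i 0| <= b i.
Proof.
move=> /(mulmx_coord_bounded B) [bU [bU_ge0 le_bU]].
move=> /(mulmx_coord_bounded D) [bW [bW_ge0 le_bW]].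
exists (fun i => bU i + bW i); split=> [i|u w Uu Ww i]; first exact: addr_ge0.
rewrite [X in `|X|]mxE [X in `|_ + X|]mxE.
by apply: (le_trans (ler_normB _ _)); rewrite lerD ?le_bU ?le_bW.
Qed.

Lemma next_stateE (R : realType) (n m p : nat)
    (B : 'M[int]_(n, m)) (D : 'M[int]_(n, p))
    (x : 'cV[R]_n) (u : 'cV[int]_m) (w : 'cV[int]_p) (i : 'I_n) :
  next_state B D x u w i 0 = x i 0 + ((B *m u - D *m w) i 0)%:~R.
Proof. by rewrite /next_state -addrA -map_mxB mxE [X in _ + X]mxE. Qed.

Lemma U_sign_vec_pow (U W : set int) (n m p : nat)
    (B : 'M[int]_(n, m)) (D : 'M[int]_(n, p)) (s : sign) (i : 'I_n) u :
  U_sign U W B D s i u -> vec_pow U u.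
Proof. by case: s => -[]. Qed.

(** The indicator of the coordinates of [x] that exceed the thresholds [c]. *)
Definition round_at (R : realType) (n : nat) (c : 'I_n -> R) (x : 'cV[R]_n) :
    'cV[R]_n :=
  \col_i (c i < x i 0)%R%:R.

Lemma round_at_binary (R : realType) (n : nat) (c : 'I_n -> R) (x : 'cV[R]_n) :
  binary_vec (round_at c x).
Proof. by move=> i; rewrite mxE; case: (c i < x i 0); [right | left]. Qed.

Lemma signature_round_at (R : realType) (n : nat) (c : 'I_n -> R)
    (x : 'cV[R]_n) (i : 'I_n) :
  signature (round_at c x) i = if c i < x i 0 then Minus else Plus.
Proof. by rewrite /signature mxE; case: (c i < x i 0); rewrite ?ltr01 ?ltxx. Qed.

(** The side has length twice the largest possible movement [b] so that each half
leaves room for a full movement towards the other half; the sign condition rules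
out movement towards the nearer end. *)
Lemma next_state_coord_in_side (R : realType) (U W : set int) (n m p : nat)
    (B : 'M[int]_(n, m)) (D : 'M[int]_(n, p)) (i : 'I_n) (b : int)
    (x : 'cV[R]_n) (u : 'cV[int]_m) (w : 'cV[int]_p) :
  U_sign U W B D (if b%:~R < x i 0 then Minus else Plus) i u ->
  vec_pow W w ->
  `|(B *m u - D *m w) i 0| <= b ->
  0 <= x i 0 <= 2 * b%:~R ->
  0 <= next_state B D x u w i 0 <= 2 * b%:~R.
Proof.
rewrite next_stateE ler_norml; case: ltP => [b_lt_x|x_le_b] [_ sgn] Ww;
  move: (sgn w Ww); rewrite -!(ler_int R) ?rmorphN /=; lra.
Qed.

Lemma U_at_of_invariant_hyperbox (R : realType) (U W : set int) (n m p : nat)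
    (B : 'M[int]_(n, m)) (D : 'M[int]_(n, p)) (X : set 'cV[R]_n) :
  is_hyperbox X -> robustly_control_invariant U W B D X ->
  forall z : 'cV[R]_n, binary_vec z -> U_at U W B D z !=set0.
Proof.
move=> [xplus [xplus_ge0 ->]] [phi [phiU phiX]] z z01.
(* The vertex of the box singled out by [z]. *)
pose x : 'cV[R]_n := \col_i (z i 0 * xplus i 0).
have Xx : [set x | forall i, 0 <= x i 0 <= xplus i 0] x.
  move=> i; have := xplus_ge0 i; rewrite mxE.
  by case: (z01 i) => ->; rewrite ?mul0r ?mul1r lexx ?andbT // => ->.
exists (phi x) => i _; rewrite /signature.
have move_in w : vec_pow W w ->
    0 <= z i 0 * xplus i 0 + ((B *m phi x - D *m w) i 0)%:~R <= xplus i 0.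
  by move=> /(phiX x w Xx) /(_ i); rewrite next_stateE mxE.
case: (z01 i) move_in => ->; rewrite ?ltxx ?ltr01 => move_in.
all: split=> [|w /move_in]; [exact: phiU | rewrite -(ler_int R); lra].
Qed.

Lemma invariant_hyperbox_of_U_at (R : realType) (U W : set int) (n m p : nat)
    (B : 'M[int]_(n, m)) (D : 'M[int]_(n, p)) :
  (1 <= n)%N -> finite_set U -> finite_set W ->
  (forall z : 'cV[R]_n, binary_vec z -> U_at U W B D z !=set0) ->
  exists X : set 'cV[R]_n,
    is_hyperbox X /\ robustly_control_invariant U W B D X.
Proof.
move=> n_gt0 Ufin Wfin U_ne.
have [b [b_ge0 le_b]] := increment_bounded B D Ufin Wfin.
pose side : 'cV[R]_n := \col_i (2 * (b i)%:~R).
exists [set x | forall i, 0 <= x i 0 <= side i 0]; split.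
  by exists side; split=> // i; rewrite mxE mulr_ge0 // ler0z.
pose z (x : 'cV[R]_n) := round_at (fun i => (b i)%:~R) x.
have z01 (x : 'cV[R]_n) : binary_vec (z x) by exact: round_at_binary.
pose phi (x : 'cV[R]_n) := sval (cid (U_ne (z x) (z01 x))).
have phiP (x : 'cV[R]_n) i :
    U_sign U W B D (if (b i)%:~R < x i 0 then Minus else Plus) i (phi x).
  by have := svalP (cid (U_ne (z x) (z01 x))) i I; rewrite signature_round_at.
have phiU (x : 'cV[R]_n) : vec_pow U (phi x).
  (* An empty intersection of sign conditions would not confine controls to [U]:
     a coordinate is needed here. *)
  exact: U_sign_vec_pow (phiP x (Ordinal n_gt0)).
exists phi; split=> [x _|x w Xx Ww i]; first exact: phiU.
have := Xx i; rewrite mxE.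
exact: next_state_coord_in_side (phiP x i) Ww (le_b _ _ (phiU x) Ww i).
Qed.

Unset Implicit Arguments.
Set Strict Implicit.

Theorem theorem1 (R : realType) (n m p : nat)
    (hn : (1 <= n)%N) (hm : (1 <= m)%N) (hp : (1 <= p)%N)
    (U W : set int)
    (Ufin : finite_set U) (Une : U !=set0)
    (Wfin : finite_set W) (Wne : W !=set0)
    (B : 'M[int]_(n, m)) (D : 'M[int]_(n, p)) :
  (exists X : set 'cV[R]_n,
      is_hyperbox X /\ robustly_control_invariant U W B D X)
  <->
  (forall z : 'cV[R]_n, binary_vec z -> U_at U W B D z !=set0).
Proof.
split=> [[X [boxX invX]]|]; first exact: U_at_of_invariant_hyperbox boxX invX.
exact: invariant_hyperbox_of_U_at.
Qed.
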